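(* Let $n\ge1$, $\beta>0$, $h_1,\dots,h_n\in\mathbb{R}$, and consider the dense Curie–Weiss model on the complete graph, $$\pi(x_1,\dots,x_n)\propto\exp\left(-\sum_{i=1}^nh_ix_i-\frac{\beta}{n}\sum_{1\le i<j\le n}x_ix_j\right),\qquad x\in\{\pm1\}^n.$$ Let $R\in\mathbb{R}^{n\times n}$ have entries $R_{ij}=\beta/n$ for $i\ne j$ and $R_{ii}=0$, with lower and upper triangular parts $R_L,R_U$. If $|\beta|\frac{n-1}{n}<1$, then the sequential, random-scan and parallel CAVI algorithms for $\pi$ (with one block per coordinate) converge globally, i.e. from any initialisation, exponentially fast in total variation distance to the fixed point $\mu_\star=\mu_\star^1\otimes\dots\otimes\mu_\star^n$ of the CAVI updates, with rates $\rho((I_n-R_L)^{-1}R_U)$ (sequential), $\rho(\frac1nR+\frac{n-1}nI_n)$ (random scan, in expectation) and $\rho(R)$ (parallel). That is, for all $k\ge0$: $T_{k+1}\preceq(I_n-R_L)^{-1}R_UT_k$ (sequential), $\mathbb{E}[T_{k+1}\mid\mu_k]\preceq(\frac1nR+\frac{n-1}nI_n)T_k$ (random scan), $T_{k+1}\preceq RT_k$ (parallel).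
   Context: The CAVI update of coordinate $i$ given the other factors $\nu^{-i}=(\nu^j)_{j\ne i}$ is $\mu_\star^i[\nu^{-i}](x_i)\propto\exp\left(-h_ix_i-\frac{\beta}{n}\sum_{j\ne i}x_i\mathbb{E}_{\nu^j}[X_j]\right)$ on $\{\pm1\}$. Sequential: $\mu_{k+1}^i=\mu_\star^i[\mu_{k+1}^{<i},\mu_k^{>i}]$ for $i=1,\dots,n$ in order; parallel: $\mu_{k+1}^i=\mu_\star^i[\mu_k^{-i}]$ for all $i$; random scan: draw $I$ uniformly on $\{1,\dots,n\}$ (independently across iterations), set $\mu_{k+1}^I=\mu_\star^I[\mu_k^{-I}]$ and leave the other coordinates unchanged. A fixed point satisfies $\mu_\star^i=\mu_\star^i[\mu_\star^{-i}]$ for all $i$. $\mathsf{TV}(\varrho,\gamma)=\frac12\sum_x|\varrho(x)-\gamma(x)|$, $T_k=(\mathsf{TV}(\mu_k^1,\mu_\star^1),\dots,\mathsf{TV}(\mu_k^n,\mu_\star^n))^\top$; $\preceq$ is entrywise; $\rho(\cdot)$ is the spectral radius. *)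

(* Defs.v *)
(* MathComp + MathComp-Analysis; real-closed only for the field R[i]. *)
From HB Require Import structures.
From mathcomp Require Import all_boot all_order all_algebra.
From mathcomp Require Import all_classical all_reals all_analysis.
From mathcomp Require Import complex.
Set Implicit Arguments.
Unset Strict Implicit.
Unset Printing Implicit Defensive.
Import Order.TTheory GRing.Theory Num.Theory.
Import numFieldNormedType.Exports.
Local Open Scope classical_set_scope.
Local Open Scope ring_scope.

Definition is_pmf (R : realType) (T : finType) (f : T -> R) : Prop :=
  (forall x, 0 <= f x) /\ \sum_x f x = 1.

(* The probability mass function proportional to f. *)
Definition normalize (R : realType) (T : finType) (f : T -> R) (x : T) : R :=
  f x / \sum_y f y.

Definition tv (R : realType) (T : finType) (f g : T -> R) : R :=
  2^-1 * \sum_x `|f x - g x|.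

(* The two-point space {-1, 1} is represented by bool. *)
Definition spin (R : realType) (b : bool) : R := if b then 1 else -1.

Definition spin_mean (R : realType) (f : bool -> R) : R :=
  \sum_b f b * spin R b.

Definition factors (R : realType) (n : nat) := 'I_n -> bool -> R.

Definition prod_pmf (R : realType) (n : nat) (nu : factors R n)
    (x : {ffun 'I_n -> bool}) : R :=
  \prod_i nu i (x i).

Definition curie_weiss (R : realType) (n : nat) (beta : R) (h : 'I_n -> R) :
    {ffun 'I_n -> bool} -> R :=
  normalize (fun x : {ffun 'I_n -> bool} =>
    expR (- (\sum_i h i * spin R (x i)) - beta / n%:R *
      \sum_(i < n) \sum_(j < n | (i < j)%N) spin R (x i) * spin R (x j))).

(* Coordinate update for an arbitrary target p: proportional to
   z |-> exp (E [ln p (X_1, .., z, .., X_n)]), with z in position i and the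
   other X_j independent of laws nu j. *)
Definition coordinate_update (R : realType) (n : nat)
    (p : {ffun 'I_n -> bool} -> R) (nu : factors R n) : factors R n :=
  fun i => normalize (fun z : bool =>
    expR (\sum_(y : {ffun 'I_n -> bool} | y i == z)
            (\prod_(j | j != i) nu j (y j)) * ln (p y))).

Definition cw_update (R : realType) (n : nat) (beta : R) (h : 'I_n -> R)
    (nu : factors R n) : factors R n :=
  fun i => normalize (fun z : bool =>
    expR (- (h i * spin R z)
      - beta / n%:R * \sum_(j | j != i) spin R z * spin_mean (nu j))).

Definition fixed_point (R : realType) (n : nat)
    (upd : factors R n -> factors R n) (nu : factors R n) : Prop :=
  forall i x, nu i x = upd nu i x.

(* The value at i of each update below does not depend on the i-th factor
   of its argument, so the entry j = i of the mixed family is immaterial. *)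
Definition sequential_run (R : realType) (n : nat)
    (upd : factors R n -> factors R n) (mu : nat -> factors R n) : Prop :=
  forall k i x, mu k.+1 i x =
    upd (fun j => if (j < i)%N then mu k.+1 j else mu k j) i x.

Definition parallel_run (R : realType) (n : nat)
    (upd : factors R n -> factors R n) (mu : nat -> factors R n) : Prop :=
  forall k i x, mu k.+1 i x = upd (mu k) i x.

Definition random_scan_run (R : realType) (n : nat) (Omega : Type)
    (upd : factors R n -> factors R n) (I : nat -> Omega -> 'I_n)
    (nu0 : factors R n) (mu : nat -> Omega -> factors R n) : Prop :=
  (forall w i x, mu 0%N w i x = nu0 i x) /\
  (forall k w i x, mu k.+1 w i x =
     if i == I k w then upd (mu k w) i x else mu k w i x).

Definition iid_uniform (R : realType) (n : nat) (d : measure_display)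
    (Omega : measurableType d) (P : probability Omega R)
    (I : nat -> Omega -> 'I_n) : Prop :=
  [/\ forall k i, measurable [set w | I k w = i],
      forall k i, P [set w | I k w = i] = (n%:R^-1)%:E
    & forall (s : seq nat) (B : nat -> set 'I_n), uniq s ->
        P [set w | forall k, k \in s -> B k (I k w)] =
        (\prod_(k <- s) P (I k @^-1` B k))%E].

(* The sigma-algebra on Omega generated by the random family Y of
   probability mass functions. *)
Definition sigma_factors (R : realType) (n : nat) (Omega : Type)
    (Y : Omega -> factors R n) : set (set Omega) :=
  <<s [set A | exists i x (B : set R),
         measurable B /\ A = (fun w => Y w i x) @^-1` B] >>.

(* Y is a version of the conditional expectation E[X | G]. *)
Definition is_cond_exp (R : realType) (d : measure_display)
    (Omega : measurableType d) (P : probability Omega R)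
    (G : set (set Omega)) (X Y : Omega -> R) : Prop :=
  [/\ P.-integrable setT (EFin \o Y),
      forall B : set R, measurable B -> G (Y @^-1` B)
    & forall A, G A ->
        (\int[P]_(w in A) (Y w)%:E = \int[P]_(w in A) (X w)%:E)%E].

Definition tv_vec (R : realType) (n : nat) (mu nu : factors R n) : 'cV[R]_n :=
  \col_i tv (mu i) (nu i).

Definition lemx (R : realType) (m n : nat) (A B : 'M[R]_(m, n)) : Prop :=
  forall i j, A i j <= B i j.

(* Maximal modulus of the complex eigenvalues of a real matrix. *)
Definition spectral_radius (R : realType) (n : nat) (A : 'M[R]_n) : R :=
  sup [set r : R | exists z : R[i],
         eigenvalue (map_mx (real_complex R) A) z /\ r = Normc.normc z].

Definition lower_part (R : realType) (n : nat) (A : 'M[R]_n) : 'M[R]_n :=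
  \matrix_(i, j) if (j < i)%N then A i j else 0.

Definition upper_part (R : realType) (n : nat) (A : 'M[R]_n) : 'M[R]_n :=
  \matrix_(i, j) if (i < j)%N then A i j else 0.

Definition cw_mx (R : realType) (n : nat) (beta : R) : 'M[R]_n :=
  \matrix_(i, j) if i == j then 0 else beta / n%:R.

Definition sequential_mx (R : realType) (n : nat) (A : 'M[R]_n) : 'M[R]_n :=
  invmx (1%:M - lower_part A) *m upper_part A.

Definition random_scan_mx (R : realType) (n : nat) (A : 'M[R]_n) : 'M[R]_n :=
  n%:R^-1 *: A + ((n%:R - 1) / n%:R) *: 1%:M.

(* Main.v *)
(* On {-1, 1} a law is determined by its mean, and the coordinate update is a
   sigmoid of an affine function of the other means; the sigmoid being
   1/4-Lipschitz, updating i contracts total variation with weights the i-th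
   row of the matrix R. Each recursion T_{k+1} <= M T_k has a nonnegative M
   with a positive right eigenvector v, M v = l v, hence T_k = O(l^k) and l is
   the spectral radius. For R and the random-scan matrix v is constant; for the
   sequential matrix v = (q^i)_i and l = q^n, where q in (0, 1) solves
   q^(n-1) = (beta / n) (1 + q + .. + q^(n-2)).
   In the random scan the state is a function of the past draws, which are
   uniform on a finite set, so all integrals are finite sums. *)
Require Import Defs.
From HB Require Import structures.
From mathcomp Require Import all_boot all_order all_algebra.
From mathcomp Require Import all_classical all_reals all_analysis.
From mathcomp Require Import complex.
From mathcomp Require Import ring lra.
Set Implicit Arguments.
Unset Strict Implicit.
Unset Printing Implicit Defensive.
Import Order.TTheory GRing.Theory Num.Theory.
Import numFieldNormedType.Exports.
Local Open Scope classical_set_scope.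
Local Open Scope ring_scope.

(** * Spectral radius and decay of recursions from a positive eigenvector *)

Section NonnegativeMatrices.
Variables (R : realType) (n : nat).
Implicit Types (A : 'M[R]_n) (v x y : 'cV[R]_n).

Lemma normc_sum (I : finType) (F : I -> R[i]) :
  Normc.normc (\sum_i F i) <= \sum_i Normc.normc (F i).
Proof.
elim/big_ind2: _ => [|a b c d ab cd|//]; first by rewrite Normc.normc0.
by apply: le_trans (lerD ab cd); exact: le_normcD.
Qed.

Lemma normc_real (a : R) : 0 <= a -> Normc.normc (real_complex R a) = a.
Proof. by move=> a0; rewrite /= expr0n /= addr0 sqrtr_sqr ger0_norm. Qed.

Lemma normc_ge0 (z : R[i]) : 0 <= Normc.normc z.
Proof. by case: z => a b /=; exact: sqrtr_ge0. Qed.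

(* Pairing the moduli of a left eigenvector for z with the positive right
   eigenvector v gives |z| <= l. *)
Lemma spectral_radius_perron A v (l : R) : (0 < n)%N ->
  (forall i j, 0 <= A i j) -> (forall i, 0 < v i 0) -> 0 <= l ->
  A *m v = l *: v -> spectral_radius A = l.
Proof.
move=> n0 A0 v0 l0 Av; rewrite /spectral_radius.
set S := [set r | _].
have Sl : S l.
  exists (real_complex R l); split; last by rewrite normc_real.
  (* [eigenvalue] refers to row vectors, while v is a column: A - l I annihilates v, so it is
     singular, and the characteristic polynomial carries this from R to R[i]. *)
  rewrite eigenvalue_root_char -map_char_poly fmorph_root.
  rewrite -eigenvalue_root_char /eigenvalue /eigenspace kermx_eq0.
  rewrite row_free_unit; apply/negP => u.
  have : (A - l%:M) *m v = 0 by rewrite mulmxBl Av mul_scalar_mx subrr.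
  move/(congr1 (mulmx (invmx (A - l%:M)))); rewrite mulKmx // mulmx0 => vz.
  by have := v0 (Ordinal n0); rewrite vz mxE ltxx.
have ubS : ubound S l.
  move=> _ [z [/eigenvalueP[w wA w0] ->]].
  have wj j : Normc.normc z * Normc.normc (w 0 j) <=
      \sum_i Normc.normc (w 0 i) * A i j.
    rewrite -Normc.normcM; move/matrixP/(_ 0 j): wA; rewrite !mxE => <-.
    apply: le_trans (normc_sum _) _; apply: ler_sum => i _.
    by rewrite mxE Normc.normcM normc_real.
  have s0 : 0 < \sum_j Normc.normc (w 0 j) * v j 0.
    case/rV0Pn: w0 => j wj0; rewrite (bigD1 j) //= ltr_wpDr //.
      by apply: sumr_ge0 => i _; rewrite mulr_ge0 ?normc_ge0 // ltW.
    rewrite mulr_gt0 // lt_neqAle normc_ge0 andbT eq_sym.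
    by apply: contra_neq wj0 => /Normc.eq0_normc.
  rewrite -(ler_pM2r s0) mulr_sumr.
  apply: (@le_trans _ _ (\sum_j (\sum_i Normc.normc (w 0 i) * A i j) * v j 0)).
    by apply: ler_sum => j _; rewrite mulrA ler_wpM2r // ltW.
  under eq_bigr do rewrite mulr_suml.
  rewrite exchange_big /= mulr_sumr; apply: ler_sum => i _.
  move/matrixP/(_ i 0): Av; rewrite !mxE => Avi.
  rewrite mulrCA -Avi mulr_sumr.
  by under eq_bigr do rewrite -mulrA.
apply/eqP; rewrite eq_le; apply/andP; split.
  by apply: ge_sup => //; exists l.
by apply: ub_le_sup => //; exists l.
Qed.

(** A nonnegative matrix preserves the entrywise order, so a bound by C l^k v passes through A and
    becomes, by A v = l v, a bound by C l^(k+1) v. *)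
Lemma perron_decay A v (l : R) (t : nat -> 'cV[R]_n) :
  (forall i j, 0 <= A i j) -> (forall i, 0 < v i 0) ->
  A *m v = l *: v -> (forall k, lemx (t k.+1) (A *m t k)) ->
  exists C, forall k, lemx (t k) ((C * l ^+ k) *: v).
Proof.
move=> A0 v0 Av tA.
(* The sum of the ratios bounds each of them, which settles k = 0. *)
exists (\sum_i `|t 0%N i 0| / v i 0); elim=> [|k IH] i j; rewrite ?ord1.
  rewrite mxE expr0 mulr1 (bigD1 i) //= mulrDl mulfVK ?gt_eqF //.
  rewrite (le_trans (ler_norm _)) // lerDl mulr_ge0 ?(ltW (v0 i)) //.
  by apply: sumr_ge0 => m _; rewrite divr_ge0 // ltW.
apply: le_trans (tA k i 0) _; rewrite exprSr mulrA -[X in X *: v]mulrA mulrA.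
rewrite -scalerA -Av scalemxAr !mxE; apply: ler_sum => m _.
by apply: ler_wpM2l => //; exact: IH.
Qed.

End NonnegativeMatrices.

(** * The sequential matrix (I - L)^-1 U of a nonnegative matrix *)

Section SequentialMatrix.
Variables (R : realType) (n : nat) (A : 'M[R]_n).
Hypothesis A_ge0 : forall i j, 0 <= A i j.

(** Forward substitution: row i expresses x_i through earlier entries with nonnegative weights, so
    strong induction on i transfers the inequality. *)
Lemma lower_part_solve_le (x y : 'cV[R]_n) :
  lemx ((1%:M - lower_part A) *m x) ((1%:M - lower_part A) *m y) -> lemx x y.
Proof.
move=> xy i j; rewrite ord1 {j}.
have [m] := ubnP (i : nat); elim: m i => // m IH i im.
have := xy i 0; rewrite !mulmxBl !mul1mx !mxE lerBlDr -addrA => h.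
apply: le_trans h _; rewrite gerDl addrC subr_le0.
apply: ler_sum => k _; rewrite !mxE; case: ifP => ki; last by rewrite !mul0r.
by apply: ler_wpM2l => //; apply: IH; exact: leq_trans ki _.
Qed.

Lemma lower_part_unit : 1%:M - lower_part A \in unitmx.
Proof.
rewrite unitmxE det_trig; last first.
  apply/is_trig_mxP => i j ij; rewrite !mxE ltnNge (ltnW ij) /=.
  by rewrite -val_eqE /= (ltn_eqF ij) subrr.
by rewrite big1 ?unitr1 // => i _; rewrite !mxE eqxx ltnn subr0.
Qed.

Lemma sequential_mxK (x : 'cV[R]_n) :
  (1%:M - lower_part A) *m (sequential_mx A *m x) = upper_part A *m x.
Proof. by rewrite /sequential_mx !mulmxA mulmxV ?lower_part_unit // mul1mx. Qed.

(** Column j solves (I - L) x = U e_j, whose right side is nonnegative, so x can be compared with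
    the zero vector. *)
Lemma sequential_mx_ge0 i j : 0 <= sequential_mx A i j.
Proof.
have -> : sequential_mx A i j = (sequential_mx A *m delta_mx j 0 : 'cV_n) i 0.
  by rewrite -colE [RHS]mxE.
have /lower_part_solve_le/(_ i 0) :
  lemx ((1%:M - lower_part A) *m (0 : 'cV[R]_n))
    ((1%:M - lower_part A) *m (sequential_mx A *m delta_mx j 0)).
  move=> k l; rewrite sequential_mxK mulmx0 -colE (ord1 l) !mxE.
  by case: ifP.
by rewrite mxE.
Qed.

(** In a sequential sweep row i sees new values x_j for j < i and old values y_j afterwards. Moving
    the new ones to the left gives (I - L) x <= U y; the zero diagonal settles j = i. *)
Lemma sequential_mx_le (x y : 'cV[R]_n) :
  (forall i, x i 0 <= \sum_j A i j * (if (j < i)%N then x j 0 else y j 0)) ->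
  (forall i, A i i = 0) -> lemx x (sequential_mx A *m y).
Proof.
move=> xy A0; apply: lower_part_solve_le => i j; rewrite (ord1 j).
rewrite sequential_mxK mulmxBl mul1mx !mxE lerBlDr -big_split /=.
apply: le_trans (xy i) _; apply: ler_sum => k _; rewrite !mxE.
case: ltngtP => [|_|/val_inj ->]; rewrite ?mul0r ?addr0 ?add0r //.
by rewrite A0 mul0r.
Qed.

End SequentialMatrix.

(** * Positive eigenvectors of the Curie-Weiss matrices *)

Section CurieWeissMatrix.
Variables (R : realType) (n : nat).
Implicit Types a beta : R.

Lemma cw_mx_ge0 beta : 0 <= beta -> forall i j, 0 <= cw_mx n beta i j.
Proof. by move=> b0 i j; rewrite mxE; case: ifP => // _; rewrite divr_ge0. Qed.

Lemma cw_mx_mulmx beta (x : 'cV[R]_n) i :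
  (cw_mx n beta *m x) i 0 = beta / n%:R * \sum_(j | j != i) x j 0.
Proof.
rewrite mxE (bigD1 i) //= mxE eqxx mul0r add0r mulr_sumr.
by apply: eq_bigr => j ji; rewrite mxE eq_sym (negbTE ji).
Qed.

Lemma cw_mx_const beta :
  cw_mx n beta *m (const_mx 1 : 'cV[R]_n) =
  (beta * ((n%:R - 1) / n%:R)) *: const_mx 1.
Proof.
apply/matrixP => i j; rewrite (ord1 j) cw_mx_mulmx !mxE.
under eq_bigr do rewrite mxE.
have n0 : (0 < n)%N by exact: leq_ltn_trans (ltn_ord i).
rewrite sumr_const (cardC1 i) card_ord mulr1 -subn1 natrB //.
by rewrite mulrAC mulrA.
Qed.

Lemma random_scan_mx_const beta : (0 < n)%N ->
  random_scan_mx (cw_mx n beta) *m (const_mx 1 : 'cV[R]_n) =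
  (beta * ((n%:R - 1) / n%:R) / n%:R + (n%:R - 1) / n%:R) *: const_mx 1.
Proof.
move=> n0; rewrite mulmxDl -!scalemxAl cw_mx_const mul1mx scalerA -scalerDl.
by rewrite [n%:R^-1 * _]mulrC.
Qed.

Lemma random_scan_mx_ge0 beta : 0 <= beta -> (0 < n)%N ->
  forall i j, 0 <= random_scan_mx (cw_mx n beta) i j.
Proof.
move=> b0 n0 i j; have n1 : 0 <= n%:R - 1 :> R by rewrite subr_ge0 ler1n.
rewrite 2!mxE [X in _ + X]mxE [X in _ + _ * X]mxE.
by rewrite addr_ge0 // mulr_ge0 ?invr_ge0 ?divr_ge0 ?cw_mx_ge0 // mulrn_wge0.
Qed.

(* q is the root in (0, 1) of X^(n-1) - a (1 + X + .. + X^(n-2)), and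
   (q^i)_i is the Perron eigenvector, for the eigenvalue q^n. *)
Lemma geometric_ratio_exists a : (1 < n)%N -> 0 < a -> a * (n%:R - 1) < 1 ->
  exists2 q, 0 < q < 1 & q ^+ n.-1 = a * \sum_(j < n.-1) q ^+ j.
Proof.
move=> n1 a0 an.
pose p : {poly R} := 'X^(n.-1) - a *: \sum_(j < n.-1) 'X^j.
have pE x : p.[x] = x ^+ n.-1 - a * \sum_(j < n.-1) x ^+ j.
  rewrite !hornerE horner_sum; congr (_ - _ * _).
  by apply: eq_bigr => j _; rewrite !hornerE.
have n2 : n.-1 = n.-2.+1 by case: (n) n1 => [|[|m]].
(* The value at 0 is -a, as n > 1 leaves the constant term in the sum; the value at 1 is 1 - a (n -
   1). Strict opposite signs put a root strictly between. *)
have p0 : p.[0] < 0.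
  rewrite pE n2 expr0n /= sub0r oppr_lt0 big_ord_recl expr0 big1 ?addr0 ?mulr1 //.
  by move=> i _; rewrite exprS mul0r.
have p1 : 0 < p.[1].
  rewrite pE expr1n subr_gt0; under eq_bigr do rewrite expr1n.
  by rewrite sumr_const card_ord -subn1 natrB // ltnW.
have [|q /andP[q0 q1] /rootP pq] := @poly_ivt R p 0 1 ler01.
  by rewrite (ltW p0) (ltW p1).
exists q; last by apply/eqP; rewrite -subr_eq0 -pE pq.
rewrite !lt_neqAle q0 q1 !andbT; apply/andP; split; apply/eqP => qE.
  by move: p0; rewrite [X in p.[X]]qE pq ltxx.
by move: p1; rewrite -qE pq ltxx.
Qed.

(** It suffices that U v = (I - L) (q^n v). Both L v and U v consist of partial geometric sums times
    a, and the equation for q gives a (1 + .. + q^(n-1)) = a + q^n. *)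
Lemma sequential_cw_eigen beta q : (1 < n)%N -> 0 <= beta -> 0 < q < 1 ->
  q ^+ n.-1 = beta / n%:R * \sum_(j < n.-1) q ^+ j ->
  sequential_mx (cw_mx n beta) *m (\col_i q ^+ i : 'cV[R]_n) =
  q ^+ n *: \col_i q ^+ i.
Proof.
move=> n1 b0 /andP[q0 q1] qn; set a := beta / n%:R in qn.
set A := cw_mx n beta; set v : 'cV[R]_n := \col_i _.
have A0 := cw_mx_ge0 b0.
have nE : n = n.-1.+1 by case: (n) n1.
have low (i : 'I_n) : (lower_part A *m v) i 0 = a * \sum_(j < i) q ^+ j.
  rewrite mxE (big_ord_widen n (fun j => q ^+ j) (ltnW (ltn_ord i))).
  rewrite mulr_sumr [RHS]big_mkcond /=; apply: eq_bigr => j _; rewrite !mxE.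
  by case: ifP => ji; rewrite ?mul0r // -val_eqE /= gtn_eqF.
have full : a * \sum_(j < n) q ^+ j = a + q ^+ n.
  rewrite nE big_ord_recl expr0 mulrDr mulr1 exprS qn mulrCA; congr (_ + _ * _).
  by rewrite mulr_sumr; apply: eq_bigr => j _; rewrite exprS.
have up (i : 'I_n) :
    (upper_part A *m v) i 0 = a + q ^+ n - a * \sum_(j < i.+1) q ^+ j.
  rewrite -full (big_ord_widen n (fun j => q ^+ j) (ltn_ord i)) -mulrBr.
  rewrite [X in X - _](bigID (fun j : 'I_n => (j < i.+1)%N)) /= addrAC subrr add0r.
  rewrite mxE mulr_sumr [RHS]big_mkcond /=; apply: eq_bigr => j _; rewrite !mxE.
  rewrite -leqNgt; case: ifP => ij; rewrite ?mul0r // -val_eqE /= ltn_eqF //.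
have geo m : (1 - q) * \sum_(j < m) q ^+ j = 1 - q ^+ m.
  by rewrite -opprB mulNr -subrX1 opprB.
have aq : a * (1 - q ^+ n.-1) = q ^+ n.-1 * (1 - q).
  by rewrite -geo qn; ring.
have key : upper_part A *m v = (1%:M - lower_part A) *m (q ^+ n *: v).
  apply/matrixP => i j; rewrite (ord1 j) up mulmxBl mul1mx -scalemxAr.
  rewrite mxE [X in _ = X + _]mxE [X in _ = _ + X]mxE [X in _ = _ - X]mxE low mxE.
  (* Multiplying by 1 - q turns the partial sums into powers of q; the closed form of the equation
     for q then removes the products a q^n. *)
  apply: (mulfI (x := 1 - q)); first by rewrite subr_eq0 gt_eqF.
  transitivity ((1 - q) * (a + q ^+ n) - a * (1 - q ^+ i.+1)).
    by rewrite -geo; ring.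
  transitivity (q ^+ n * ((1 - q) * q ^+ i - a * (1 - q ^+ i))); last first.
    by rewrite -geo; ring.
  have aqn : a * q ^+ n = a * q - (1 - q) * q ^+ n.
    move: aq; rewrite nE !exprS => /(congr1 (fun x => q * x)) /=; lra.
  rewrite exprS.
  transitivity ((1 - q) * q ^+ n - a * q + a * q * q ^+ i); first by ring.
  transitivity ((1 - q) * q ^+ n * q ^+ i - (a * q ^+ n) + (a * q ^+ n) * q ^+ i).
    by rewrite aqn; ring.
  by ring.
by rewrite -[LHS](mulKmx (lower_part_unit A)) sequential_mxK key mulKmx // lower_part_unit.
Qed.

Lemma sequential_cw_mx1 beta : n = 1%N -> sequential_mx (cw_mx n beta) = 0.
Proof.
move=> n1; rewrite /sequential_mx.
suff -> : upper_part (cw_mx n beta) = 0 by rewrite mulmx0.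
apply/matrixP => i j; rewrite !mxE; case: ifP => // ij.
have := ltn_ord j; rewrite [X in (_ < X)%N]n1 ltnS leqn0 => /eqP j0.
by rewrite j0 in ij.
Qed.

(** A single coordinate is a case apart: the equation for q would read 1 = 0, but the matrix
    vanishes and l = 0 serves. *)
Lemma sequential_perron beta : (0 < n)%N -> 0 < beta ->
  beta * ((n%:R - 1) / n%:R) < 1 ->
  exists (v : 'cV[R]_n) (l : R), [/\ forall i, 0 < v i 0, 0 <= l < 1 &
    sequential_mx (cw_mx n beta) *m v = l *: v].
Proof.
move=> n0 b0 bn; have [n1|n1|n1] := ltngtP n 1%N.
- by case: (n) n0 n1.
- have [||q q01 qn] := @geometric_ratio_exists (beta / n%:R) n1.
    by rewrite divr_gt0 // ltr0n.
    by rewrite mulrAC -mulrA.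
  exists (\col_i q ^+ i), (q ^+ n); split.
  + by move=> i; rewrite mxE exprn_gt0 //; case/andP: q01.
  + by case/andP: q01 => q0 q1; rewrite exprn_ge0 ?exprn_ilt1 // ?ltW // -lt0n.
  + exact: sequential_cw_eigen (ltW b0) q01 qn.
- exists (const_mx 1), 0; split => [i||]; rewrite ?mxE ?lexx ?ltr01 //.
  by rewrite sequential_cw_mx1 // mul0mx scale0r.
Qed.

End CurieWeissMatrix.

(** * Total variation on two points and on products *)

Section ProductMeasures.
Variable R : realType.

Lemma sum_bool (F : bool -> R) : \sum_b F b = F true + F false.
Proof. by rewrite big_bool. Qed.

Lemma tv_ge0 (T : finType) (f g : T -> R) : 0 <= tv f g.
Proof. by rewrite mulr_ge0 ?invr_ge0 // sumr_ge0. Qed.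

Lemma eq_tv (T : finType) (f f' g g' : T -> R) :
  f =1 f' -> g =1 g' -> tv f g = tv f' g'.
Proof.
by move=> ff' gg'; congr (_ * _); apply: eq_bigr => x _; rewrite ff' gg'.
Qed.

Lemma tv_eq0 (T : finType) (f g : T -> R) : tv f g = 0 -> f =1 g.
Proof.
move/eqP; rewrite mulf_eq0 invr_eq0 pnatr_eq0 /= => /eqP fg x; apply/eqP.
move/(psumr_eq0P (fun=> fun=> normr_ge0 _)): fg => /(_ x isT)/eqP.
by rewrite normr_eq0 subr_eq0.
Qed.

Lemma pmf_false (f : bool -> R) : is_pmf f -> f false = 1 - f true.
Proof. by case=> _; rewrite sum_bool => <-; rewrite addrAC subrr add0r. Qed.

Lemma tv_pmf_bool (f g : bool -> R) : is_pmf f -> is_pmf g ->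
  tv f g = `|f true - g true|.
Proof.
move=> pf pg; rewrite /tv sum_bool (pmf_false pf) (pmf_false pg).
rewrite (_ : 1 - f true - (1 - g true) = - (f true - g true)); last by ring.
by rewrite normrN; field.
Qed.

Lemma spin_mean_pmf (f : bool -> R) : is_pmf f -> spin_mean f = 2 * f true - 1.
Proof.
by move=> pf; rewrite /spin_mean sum_bool /= (pmf_false pf); ring.
Qed.

Lemma normalize_pmf (T : finType) (f : T -> R) (t : T) :
  (forall x, 0 < f x) -> is_pmf (normalize f).
Proof.
move=> f0; have s0 : 0 < \sum_y f y.
  by rewrite (bigD1 t) //= ltr_wpDr // sumr_ge0 // => i _; exact: ltW.
split=> [x|]; first by rewrite divr_ge0 // ltW.
by rewrite -mulr_suml divff // gt_eqF.
Qed.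

(** Lets terms free of the updated spin be dropped from an exponent. *)
Lemma normalize_scale (T : finType) (c : R) (f g : T -> R) : c != 0 ->
  (forall x, f x = c * g x) -> normalize f =1 normalize g.
Proof.
move=> c0 fg x; rewrite /normalize fg.
under eq_bigr do rewrite fg.
by rewrite -mulr_sumr invfM mulrACA mulfV // mul1r.
Qed.

(* Hybrid argument: factors are exchanged one at a time. *)
Lemma tv_prod_pmf n (f g : factors R n) :
  (forall i, is_pmf (f i)) -> (forall i, is_pmf (g i)) ->
  tv (prod_pmf f) (prod_pmf g) <= \sum_i tv (f i) (g i).
Proof.
move=> pf pg.
(* The hybrids run from f at k = 0 to g at k = n. *)
pose hyb k : factors R n := fun j => if (j < k)%N then g j else f j.
have step (k : 'I_n) :
  \sum_(x : {ffun 'I_n -> bool}) `|prod_pmf (hyb k.+1) x - prod_pmf (hyb k) x|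
  = \sum_b `|f k b - g k b|.
  (* Consecutive hybrids differ in factor k only, so the absolute difference is again a product, and
     its other factors sum to 1. *)
  pose w (j : 'I_n) b := if j == k then `|f k b - g k b| else hyb k j b.
  transitivity (\sum_(x : {ffun 'I_n -> bool}) \prod_j w j (x j)).
    apply: eq_bigr => x _; rewrite /prod_pmf !(bigD1 k (P := xpredT)) //=.
    have -> : \prod_(j | j != k) hyb k.+1 j (x j) = \prod_(j | j != k) hyb k j (x j).
      apply: eq_bigr => j jk; rewrite /hyb ltnS leq_eqVlt.
      by rewrite -val_eqE /= in jk; rewrite (negbTE jk).
    rewrite /w eqxx /hyb ltnSn ltnn -mulrBl normrM distrC; congr (_ * _).
    rewrite ger0_norm; last first.
      by apply: prodr_ge0 => j _; case: ifP => _; [case: (pg j)|case: (pf j)].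
    by apply: eq_bigr => j /negbTE ->.
  rewrite -bigA_distr_bigA (bigD1 k) //= [X in _ * X]big1 ?mulr1.
    by apply: eq_bigr => b _; rewrite /w eqxx.
  move=> j /negbTE jk; rewrite /w jk /hyb.
  by case: ifP => _; [case: (pg j)|case: (pf j)].
rewrite /tv -mulr_sumr ler_pM2l ?invr_gt0 //.
under [leRHS]eq_bigr do rewrite -step.
rewrite exchange_big /=; apply: ler_sum => x _.
apply: le_trans (ler_norm_sum _ _ _).
rewrite -(big_mkord xpredT (fun k => prod_pmf (hyb k.+1) x - prod_pmf (hyb k) x)).
rewrite telescope_sumr // distrC le_eqVlt; apply/orP; left; apply/eqP.
by congr (`| _ - _ |); apply: eq_bigr => j _; rewrite /hyb ?ltn_ord.
Qed.

End ProductMeasures.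

(** * The logistic function *)

Section Sigmoid.
Variable R : realType.

(** The decreasing logistic function: s is the exponent at [false] minus the exponent at [true]. *)
Definition sigmoid (s : R) : R := (1 + expR s)^-1.

Lemma normalize_exp_bool (f : bool -> R) :
  normalize (fun b => expR (f b)) true = sigmoid (f false - f true).
Proof.
rewrite /normalize /sigmoid sum_bool expRD expRN.
by field; rewrite !gt_eqF ?addr_gt0 ?expR_gt0.
Qed.

Lemma is_derive_sigmoid (x : R) :
  is_derive x 1 sigmoid (- expR x / (1 + expR x) ^+ 2).
Proof.
have nz : 1 + expR x != 0 by rewrite gt_eqF // addr_gt0 ?expR_gt0.
have := is_deriveD (is_derive_cst (1 : R) x 1) (is_derive_expR x).
rewrite add0r => H; apply: (is_derive_eq (is_deriveV (f := fun y => 1 + expR y) nz H)).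
by rewrite /GRing.scale /= mulNr mulrC mulNr.
Qed.

(** Mean value theorem: e^c / (1 + e^c)^2 is at most 1/4 because (1 - e^c)^2 is nonnegative. *)
Lemma sigmoid_lipschitz (x y : R) : `|sigmoid x - sigmoid y| <= 4^-1 * `|x - y|.
Proof.
wlog xy : x y / y <= x.
  move=> H; have [|/ltW] := leP y x; first exact: H.
  by move=> /H; rewrite distrC [`|y - x|]distrC.
have [||c _ ->] := @MVT_segment R sigmoid (fun x => - expR x / (1 + expR x) ^+ 2) y x xy.
- by move=> z _; exact: is_derive_sigmoid.
- apply: derivable_within_continuous => z _.
  by have [] := is_derive_sigmoid z.
rewrite normrM ler_wpM2r // mulNr normrN ger0_norm; last first.
  by rewrite divr_ge0 ?expR_ge0 // exprn_ge0 // addr_ge0 ?expR_ge0.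
rewrite ler_pdivrMr ?exprn_gt0 ?addr_gt0 ?expR_gt0 //.
have := sqr_ge0 (1 - expR c); rewrite -subr_ge0; lra.
Qed.

End Sigmoid.

(** * Contraction of the coordinate update and its fixed point *)

Section CurieWeissUpdate.
Variables (R : realType) (n : nat) (beta : R) (h : 'I_n -> R).
Hypothesis beta_ge0 : 0 <= beta.
Implicit Types nu : factors R n.

Let upd := cw_update beta h.

Lemma cw_update_pmf nu i : is_pmf (upd nu i).
Proof. by apply: (normalize_pmf true) => z; exact: expR_gt0. Qed.

Lemma cw_update_true nu i : upd nu i true =
  sigmoid (2 * (h i + beta / n%:R * \sum_(j | j != i) spin_mean (nu j))).
Proof.
rewrite /upd /cw_update normalize_exp_bool -!mulr_sumr /=; congr sigmoid; ring.
Qed.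

(* The sigmoid is 1/4-Lipschitz; half of the factor 4 is recovered from the
   exponent 2, and the other half from spin_mean = 2 p - 1. *)
Lemma cw_update_lipschitz nu nu' i :
  `|upd nu i true - upd nu' i true| <=
  2^-1 * (beta / n%:R * \sum_(j | j != i) `|spin_mean (nu j) - spin_mean (nu' j)|).
Proof.
rewrite !cw_update_true; apply: le_trans (sigmoid_lipschitz _ _) _.
rewrite -mulrBr opprD addrACA subrr add0r -mulrBr -sumrB mulrA normrM.
rewrite ger0_norm ?mulr_ge0 ?divr_ge0 //.
have -> (a b : R) : 4^-1 * (2 * a * b) = 2^-1 * (a * b) by field.
by rewrite !ler_wpM2l ?invr_ge0 ?divr_ge0 // ler_norm_sum.
Qed.

(** On two points the distance is the difference of the probabilities of [true]; [spin_mean] doubles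
    it, which cancels the 1/2 of the Lipschitz bound. All three recursions rest on this estimate. *)
Lemma cw_update_tv nu nu' i :
  (forall j, is_pmf (nu j)) -> (forall j, is_pmf (nu' j)) ->
  tv (upd nu i) (upd nu' i) <= \sum_j cw_mx n beta i j * tv (nu j) (nu' j).
Proof.
move=> pn pn'; rewrite (tv_pmf_bool (cw_update_pmf _ _) (cw_update_pmf _ _)).
apply: le_trans (cw_update_lipschitz _ _ _) _.
rewrite [leRHS](bigD1 i) //= mxE eqxx mul0r add0r.
under [leRHS]eq_bigr => j ji do rewrite mxE eq_sym (negbTE ji).
rewrite -mulr_sumr mulrCA ler_wpM2l ?divr_ge0 // mulr_sumr.
apply: ler_sum => j _; rewrite !spin_mean_pmf // tv_pmf_bool //.
rewrite (_ : _ - _ - _ = 2 * (nu j true - nu' j true)); last by ring.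
by rewrite normrM ger0_norm // mulKf.
Qed.

(** The distances between two fixed points form a constant sequence that satisfies the parallel
    recursion, so they are bounded by C l^k for every k and vanish. *)
Lemma cw_fixed_unique nu nu' : beta * ((n%:R - 1) / n%:R) < 1 ->
  (forall j, is_pmf (nu j)) -> (forall j, is_pmf (nu' j)) ->
  fixed_point upd nu -> fixed_point upd nu' -> forall i, nu i =1 nu' i.
Proof.
move=> b1 pn pn' fn fn' i; apply: tv_eq0; apply/eqP.
rewrite eq_le tv_ge0 andbT.
have tv0 j : 0 <= tv (nu j) (nu' j) := tv_ge0 _ _.
have n0 : (0 < n)%N by exact: leq_ltn_trans (ltn_ord i).
pose t : nat -> 'cV[R]_n := fun=> tv_vec nu nu'.
have [||||C tC] := @perron_decay R n (cw_mx n beta) (const_mx 1)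
  (beta * ((n%:R - 1) / n%:R)) t.
- exact: cw_mx_ge0.
- by move=> j; rewrite mxE.
- exact: cw_mx_const.
- move=> k j l; rewrite ord1 !mxE (eq_tv (fn j) (fn' j)).
  apply: le_trans (cw_update_tv _ pn pn') _.
  by apply: ler_sum => m _; rewrite !mxE.
set l := beta * _ in b1 tC.
have l0 : 0 <= l by rewrite mulr_ge0 // divr_ge0 // subr_ge0 ler1n.
have : (0 : R) >= tv (nu i) (nu' i); last by [].
apply: (cvgr_to_ge (@cvg_geometric _ C l _)); first by rewrite ger0_norm.
by apply: nearW => k; have := tC k i 0; rewrite !mxE mulr1.
Qed.

End CurieWeissUpdate.

(* Makes row vectors a completeNormedModType, for Banach's theorem. *)
HB.instance Definition _ (R : realType) (n : nat) := NormedModule.on 'rV[R]_n.+1.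

(** In terms of the probabilities of [true], the simultaneous update contracts the sup norm by beta
    (n - 1) / n, and Banach's theorem applies. The factors of the fixed point are laws because they
    are values of the update. *)
Lemma cw_fixed_exists (R : realType) (n : nat) (beta : R) (h : 'I_n -> R) :
  0 <= beta -> beta * ((n%:R - 1) / n%:R) < 1 -> (0 < n)%N ->
  exists nu : factors R n,
    (forall i, is_pmf (nu i)) /\ fixed_point (cw_update beta h) nu.
Proof.
move=> beta_ge0 b1 n0.
(* Here p is any real, so that Banach's theorem can be used on the whole space; the mean is still 2
   p - 1. *)
pose bern (p : R) (b : bool) := if b then p else 1 - p.
have bern_mean p : spin_mean (bern p) = 2 * p - 1.
  by rewrite /spin_mean sum_bool /=; ring.
case: n h b1 n0 => // m h b1 _.
pose nu (p : 'rV[R]_m.+1) : factors R m.+1 := fun j => bern (p 0 j).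
pose F p := \row_i cw_update beta h (nu p) i true.
set l := beta * _ in b1.
have l0 : 0 <= l by rewrite mulr_ge0 // divr_ge0 // subr_ge0 ler1n.
have lE : l = beta * (m%:R / m.+1%:R) by rewrite /l -[in X in X - 1]natr1 addrK.
have ctr : is_contraction [fun of totalfun F].
  exists (NngNum l0); split => //= -[p p'] _ /=.
  have coord j : `|p 0 j - p' 0 j| <= `|p - p'|.
    rewrite [leRHS]/Num.norm /= mx_normrE.
    have := le_bigmax _ (fun ij => `|(p - p') ij.1 ij.2|) (0, j).
    by rewrite !mxE; apply.
  rewrite [leLHS]/Num.norm /= mx_normrE; apply: bigmax_le => [|[i j] _ /=].
    by rewrite mulr_ge0.
  rewrite (ord1 i) !mxE; apply: le_trans (cw_update_lipschitz _ beta_ge0 _ _ _) _.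
  apply: (@le_trans _ _ (2^-1 * (beta / m.+1%:R *
      \sum_(k < m.+1 | k != j) 2 * `|p - p'|))).
    rewrite !ler_wpM2l ?invr_ge0 ?divr_ge0 //; apply: ler_sum => k _.
    rewrite !bern_mean (_ : _ - _ = 2 * (p 0 k - p' 0 k)); last by ring.
    by rewrite normrM ger0_norm // ler_wpM2l.
  rewrite sumr_const (cardC1 j) card_ord -mulr_natr /= lE.
  by rewrite le_eqVlt; apply/orP; left; apply/eqP; field; rewrite ?nat1r ?natr1 ?pnatr_eq0.
have [||p _ pE] := @banach_fixed_point R 'rV[R]_m.+1 setT _ ctr.
- exact: closedT.
- by exists 0.
have {pE} pE j : p 0 j = cw_update beta h (nu p) j true.
  by rewrite {1}pE /= /totalfun_ mxE.
have pmf j := cw_update_pmf beta h (nu p) j.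
have nuE j : nu p j =1 cw_update beta h (nu p) j.
  by move=> [|]; rewrite ?(pmf_false (pmf j)) /nu /bern pE.
exists (nu p); split => // i.
by have -> : nu p i = cw_update beta h (nu p) i by apply/funext.
Qed.

(** * Closed form of the coordinate update for the Curie-Weiss law *)

Section CoordinateUpdate.
Variables (R : realType) (n : nat) (nu : factors R n) (i : 'I_n).
Hypothesis nu_pmf : forall j, is_pmf (nu j).

(** Matches the configurations of the two sums, over spin i down and over spin i up, whose
    difference determines the update. *)
Definition flip (y : {ffun 'I_n -> bool}) : {ffun 'I_n -> bool} :=
  [ffun j => if j == i then ~~ y i else y j].

Lemma flipK : involutive flip.
Proof.
move=> y; apply/ffunP => j; rewrite !ffunE eqxx.
by case: eqP => [->|//]; rewrite negbK.
Qed.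

Lemma flip_ne y j : j != i -> flip y j = y j.
Proof. by move=> /negbTE ji; rewrite ffunE ji. Qed.

(** The probability of the other coordinates under nu. Sums over it fix [y i] so that each of their
    configurations counts once. *)
Definition weight (y : {ffun 'I_n -> bool}) : R := \prod_(j | j != i) nu j (y j).

Lemma weight_flip y : weight (flip y) = weight y.
Proof. by apply: eq_bigr => j ji; rewrite flip_ne. Qed.

Lemma sum_flip (F : {ffun 'I_n -> bool} -> R) :
  \sum_(y : {ffun 'I_n -> bool} | y i == false) F y =
  \sum_(y : {ffun 'I_n -> bool} | y i == true) F (flip y).
Proof.
rewrite (reindex_inj (inv_inj flipK)) /=; apply: eq_bigl => y.
by rewrite ffunE eqxx; case: (y i).
Qed.

Lemma weight_prod (phi : 'I_n -> bool -> R) :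
  \sum_(y : {ffun 'I_n -> bool} | y i == true)
    weight y * \prod_(j | j != i) phi j (y j) =
  \prod_(j | j != i) \sum_b nu j b * phi j b.
Proof.
(* The indicator in place i absorbs the constraint on [y i], so that the sum of products over all
   configurations factorises. *)
pose F j b : R := if j == i then (b == true)%:R else nu j b * phi j b.
transitivity (\sum_(y : {ffun 'I_n -> bool}) \prod_j F j (y j)).
  rewrite big_mkcond /=; apply: eq_bigr => y _.
  rewrite -big_split /= [RHS](bigD1 i) //= {1}/F eqxx.
  case: eqP => _; last by rewrite mul0r.
  by rewrite mul1r; apply: eq_bigr => j /negbTE ji; rewrite /F ji.
rewrite -bigA_distr_bigA (bigD1 i) //= sum_bool /F eqxx /= addr0 mul1r.
by apply: eq_bigr => j /negbTE ->.
Qed.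

Lemma weight_sum1 : \sum_(y : {ffun 'I_n -> bool} | y i == true) weight y = 1.
Proof.
have := weight_prod (fun _ _ => 1).
rewrite (eq_bigr weight) => [->|y _]; last by rewrite big1 ?mulr1.
apply: big1 => j _; under eq_bigr do rewrite mulr1.
by case: (nu_pmf j).
Qed.

Lemma weight_spin_mean j : j != i ->
  \sum_(y : {ffun 'I_n -> bool} | y i == true) weight y * spin R (y j) =
  spin_mean (nu j).
Proof.
move=> ji; have := weight_prod (fun k b => if k == j then spin R b else 1).
rewrite [RHS](bigD1 j) //= eqxx [X in _ * X]big1 ?mulr1 => [E|k].
  rewrite /spin_mean -E.
  apply: eq_bigr => y _; rewrite (bigD1 j) //= eqxx [X in _ * (_ * X)]big1 ?mulr1 //.
  by move=> k /andP[_ /negbTE ->].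
move=> /andP[_ /negbTE ->]; under eq_bigr do rewrite mulr1.
by case: (nu_pmf k).
Qed.

(** In the expanded square the diagonal contributes n and the two off-diagonal halves agree. The
    interaction thus depends only on the total spin. *)
Lemma pair_sum (s : 'I_n -> R) : (forall j, s j ^+ 2 = 1) ->
  2 * \sum_(j < n) \sum_(k < n | (j < k)%N) s j * s k =
  (\sum_j s j) ^+ 2 - n%:R.
Proof.
move=> s1; rewrite expr2 big_distrlr /=.
have -> : \sum_j \sum_k s j * s k = \sum_(j < n) (\sum_(k < n | (j < k)%N) s j * s k
    + \sum_(k < n | (k < j)%N) s j * s k) + n%:R.
  rewrite -[n in X in _ = _ + X]card_ord -sumr_const -big_split /=.
  apply: eq_bigr => j _; rewrite (bigD1 j) //= -expr2 s1 addrC; congr (_ + _).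
  rewrite (bigID (fun k : 'I_n => (j < k)%N)) /=; congr (_ + _); apply: eq_bigl => k.
    by rewrite -val_eqE; case: ltngtP.
  by rewrite -val_eqE; case: ltngtP.
rewrite addrK big_split /=.
rewrite [X in _ + X](exchange_big_dep xpredT) //= mulrDl mul1r; congr (_ + _).
by apply: eq_bigr => j _; apply: eq_bigr => k _; rewrite mulrC.
Qed.

Variables (beta : R) (h : 'I_n -> R).

Let energy (y : {ffun 'I_n -> bool}) : R :=
  - (\sum_j h j * spin R (y j)) - beta / n%:R *
      \sum_(j < n) \sum_(k < n | (j < k)%N) spin R (y j) * spin R (y k).

(** With S the sum of the other spins, the total is S + 1 before and S - 1 after the flip; the
    squares differ by 4 S, hence the pair sums by 2 S. *)
Lemma energy_flip (y : {ffun 'I_n -> bool}) : y i = true ->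
  energy y - energy (flip y) =
  - 2 * (h i + beta / n%:R * \sum_(j | j != i) spin R (y j)).
Proof.
move=> yi.
have sq (z : {ffun 'I_n -> bool}) j : spin R (z j) ^+ 2 = 1.
  by rewrite /spin; case: (z j); rewrite ?sqrrN expr1n.
have P (z : {ffun 'I_n -> bool}) := pair_sum (sq z).
have split_i (g : 'I_n -> R) (z : {ffun 'I_n -> bool}) : \sum_j g j * spin R (z j) =
    g i * spin R (z i) + \sum_(j | j != i) g j * spin R (z j).
  by rewrite (bigD1 i).
have flipS (g : 'I_n -> R) : \sum_(j | j != i) g j * spin R (flip y j) =
    \sum_(j | j != i) g j * spin R (y j).
  by apply: eq_bigr => j ji; rewrite flip_ne.
have flipi : flip y i = false by rewrite ffunE eqxx yi.
have S1 (z : {ffun 'I_n -> bool}) : \sum_j spin R (z j) = \sum_j 1 * spin R (z j).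
  by apply: eq_bigr => j _; rewrite mul1r.
move: (P y) (P (flip y)); rewrite !S1 !split_i flipS flipi yi /= => Py Pf.
rewrite /energy !split_i flipS flipi yi /=.
have -> : \sum_(j | j != i) spin R (y j) = \sum_(j | j != i) 1 * spin R (y j).
  by apply: eq_bigr => j _; rewrite mul1r.
set Qy := \sum_(j < n) _ in Py *; set Qf := \sum_(j < n) _ in Pf *.
have -> : Qy = Qf + 2 * \sum_(j | j != i) 1 * spin R (y j).
  by apply: (mulfI (x := 2)) => //; rewrite mulrDr Py Pf; ring.
by ring.
Qed.

Lemma coordinate_update_curie_weiss (x : bool) :
  coordinate_update (curie_weiss beta h) nu i x = cw_update beta h nu i x.
Proof.
pose Z := \sum_(y : {ffun 'I_n -> bool}) expR (energy y).
have Z0 : 0 < Z.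
  rewrite /Z (bigD1 [ffun=> true]) //= ltr_wpDr ?expR_gt0 //.
  by apply: sumr_ge0 => y _; exact: expR_ge0.
have lnE y : ln (curie_weiss beta h y) = energy y - ln Z.
  by rewrite /curie_weiss /normalize ln_div ?posrE ?expR_gt0 // expRK.
pose f z := \sum_(y : {ffun 'I_n -> bool} | y i == z)
  weight y * ln (curie_weiss beta h y).
pose g z : R := - (h i * spin R z) -
  beta / n%:R * \sum_(j | j != i) spin R z * spin_mean (nu j).
(* A law on two points proportional to an exponential depends only on the difference of the
   exponents. In it ln Z cancels, and averaging [energy_flip] replaces spins by means. *)
have fg : f true - f false = g true - g false.
  rewrite /f sum_flip -sumrB.
  transitivity (\sum_(y : {ffun 'I_n -> bool} | y i == true) (- 2 * h i * weight y -
      2 * (beta / n%:R) * \sum_(j | j != i) weight y * spin R (y j))).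
    apply: eq_bigr => y /eqP yi; rewrite weight_flip -mulrBr !lnE.
    rewrite opprB addrA subrK energy_flip // -mulr_sumr; ring.
  rewrite sumrB -!mulr_sumr weight_sum1 exchange_big /=.
  rewrite (eq_bigr (fun j => spin_mean (nu j))) => [|j ji]; last first.
    exact: weight_spin_mean.
  by rewrite /g /= -!mulr_sumr; ring.
rewrite /cw_update /coordinate_update.
apply: (@normalize_scale _ _ (expR (f true - g true))) => [|z].
  by rewrite gt_eqF ?expR_gt0.
rewrite -expRD; congr expR; rewrite -/(f z) -/(g z).
by case: z; [rewrite subrK|move: fg; lra].
Qed.

End CoordinateUpdate.

(** * Integrals of functions of a finite-valued variable *)

Section FiniteValuedVariable.
Context d (Omega : measurableType d) (R : realType).
Variables (P : probability Omega R) (C : finType) (J : Omega -> C).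
Hypothesis mJ : forall c, measurable (J @^-1` [set c]).
Implicit Types (phi : C -> R) (D : set C).

Lemma finite_preimage_measurable D : measurable (J @^-1` D).
Proof.
have -> : J @^-1` D = \bigcup_(c in D) (J @^-1` [set c]).
  by apply/seteqP; split => [w Dw|w [c Dc /= ->]//]; exists (J w).
by apply: fin_bigcup_measurable => [|c _ //]; exact: finite_finset.
Qed.

(** The expansion in indicators that reduces integrals to finite sums. *)
Lemma finite_valuedE phi w :
  (phi (J w))%:E = (\sum_c (phi c)%:E * (\1_(J @^-1` [set c]) w)%:E)%E.
Proof.
rewrite (bigD1 (J w)) //= big1 => [|c cw].
  by rewrite indicE mem_set // mule1 adde0.
by rewrite indicE memNset ?mule0 // => /= Jw; rewrite Jw eqxx in cw.
Qed.

Lemma finite_valued_term_integrable D phi c : P.-integrable (J @^-1` D)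
  (fun w => ((phi c)%:E * (\1_(J @^-1` [set c]) w)%:E)%E).
Proof.
apply: (@integrableS _ _ _ P setT) => //; first exact: finite_preimage_measurable.
apply: integrableZl => //; exact: integrable_indic.
Qed.

Lemma finite_valued_integrable phi : P.-integrable setT (EFin \o (phi \o J)).
Proof.
rewrite (_ : _ \o _ =
    fun w => (\sum_c (phi c)%:E * (\1_(J @^-1` [set c]) w)%:E)%E); last first.
  by apply/funext => w; exact: finite_valuedE.
apply: integrable_sum => // c _.
by have := finite_valued_term_integrable setT phi c; rewrite preimage_setT.
Qed.

Lemma integral_finite_valued D phi :
  (\int[P]_(w in J @^-1` D) (phi (J w))%:E =
   \sum_(c | c \in D) (phi c)%:E * P (J @^-1` [set c]))%E.
Proof.
have mD := finite_preimage_measurable D.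
under eq_integral do rewrite finite_valuedE.
rewrite integral_sum //; last by move=> c; exact: finite_valued_term_integrable.
rewrite [RHS]big_mkcond /=; apply: eq_bigr => c _.
rewrite integralZl //; last first.
  apply: (@integrableS _ _ _ P setT) => //; exact: integrable_indic.
rewrite integral_indic //; case: ifPn => [|/negP]; rewrite inE => cD.
  congr (_ * P _)%E; apply/seteqP; split => [w []//|w /= Jw].
  by split => //; rewrite /preimage /= Jw.
rewrite (_ : _ `&` _ = set0) ?measure0 ?mule0 //.
by apply/seteqP; split => // w [/= -> ].
Qed.

Lemma expectation_finite_valued phi :
  ('E_P[fun w => phi (J w)] = \sum_c (phi c)%:E * P (J @^-1` [set c]))%E.
Proof.
rewrite unlock -(preimage_setT J) integral_finite_valued.
by apply: eq_bigl => c; rewrite in_setT.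
Qed.

End FiniteValuedVariable.

(** * Pointwise uniqueness of conditional expectations *)

Section ConditionalExpectation.
Context d (Omega : measurableType d) (R : realType).
Variables (P : probability Omega R) (S : set (set Omega)).
Hypothesis GM : forall A, <<s S>> A -> measurable A.
Hypothesis Gpos : forall A w, <<s S>> A -> A w -> (0 < P A)%E.

(** The set where both versions keep their values at w is a nonempty event, of positive mass by
    [Gpos]. Both are constant on it, so equal integrals over it force equal values at w. *)
Lemma is_cond_exp_unique X Y Y' :
  is_cond_exp P <<s S>> X Y -> is_cond_exp P <<s S>> X Y' -> Y =1 Y'.
Proof.
move=> [_ mY iY] [_ mY' iY'] w.
pose A := Y @^-1` [set Y w] `&` Y' @^-1` [set Y' w].
have GA : <<s S>> A.
  by apply: (@measurableI _ (g_sigma_algebraType S)); [exact: mY|exact: mY'].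
have mA := GM GA.
have : (\int[P]_(v in A) (Y v)%:E = \int[P]_(v in A) (Y' v)%:E)%E.
  by rewrite iY ?iY'.
rewrite (eq_integral (fun=> (Y w)%:E)); last first.
  by move=> v; rewrite inE => -[/= ->].
rewrite [RHS](eq_integral (fun=> (Y' w)%:E)); last first.
  by move=> v; rewrite inE => -[_ /= ->].
have PAE := fineK (fin_num_measure P _ mA).
have cstE (c : R) : (\int[P]_(v in A) c%:E = (c * fine (P A))%:E)%E.
  by rewrite integral_cst // EFinM PAE.
rewrite !cstE => -[]; apply: mulIf.
by rewrite gt_eqF // -lte_fin PAE; exact: (Gpos GA (w := w)).
Qed.

End ConditionalExpectation.

(** * The random-scan state as a function of the draws *)

Section RandomScanHistory.
Variables (R : realType) (n : nat) (upd : factors R n -> factors R n).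
Variable nu0 : factors R n.

Definition scan_step (i : 'I_n) (nu : factors R n) : factors R n :=
  fun j => if j == i then upd nu j else nu j.

(** Draws are listed with the latest first, so the head of s is applied last. *)
Definition scan_state (s : seq 'I_n) : factors R n := foldr scan_step nu0 s.

Fixpoint history (Omega : Type) (I : nat -> Omega -> 'I_n) k (w : Omega) :
    k.-tuple 'I_n :=
  if k is k'.+1 then [tuple of I k' w :: history I k' w] else [tuple].

Lemma random_scan_history Omega (I : nat -> Omega -> 'I_n) mu :
  random_scan_run upd I nu0 mu ->
  forall k w, mu k w = scan_state (history I k w).
Proof.
move=> [mu0 muS]; elim=> [|k IH] w; apply/funext => i; apply/funext => x.
  exact: mu0.
by rewrite muS /= /scan_step -IH; case: ifP.
Qed.

Lemma scan_state_pmf : (forall i, is_pmf (nu0 i)) ->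
  (forall nu i, is_pmf (upd nu i)) -> forall s i, is_pmf (scan_state s i).
Proof.
by move=> p0 pu; elim=> [|i s IH] j //=; rewrite /scan_step; case: ifP.
Qed.

Lemma sum_tuple_cons (V : nmodType) k (F : k.+1.-tuple 'I_n -> V) :
  \sum_t F t = \sum_(t : k.-tuple 'I_n) \sum_i F [tuple of i :: t].
Proof.
rewrite pair_bigA /=.
rewrite (reindex (fun p : k.-tuple 'I_n * 'I_n => [tuple of p.2 :: p.1])) //=.
exists (fun t : k.+1.-tuple 'I_n => ([tuple of behead t], thead t)) => [[t i]|t] _ /=.
  by congr pair; apply: val_inj.
by rewrite -tuple_eta.
Qed.

End RandomScanHistory.

(** * Law of the history of draws *)

Section RandomScanProbability.
Variables (R : realType) (n : nat) (d : measure_display).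
Variables (Omega : measurableType d) (P : probability Omega R).
Variables (I : nat -> Omega -> 'I_n).
Hypothesis iidI : iid_uniform P I.

(** Puts a fibre of the history into the form that the independence clause of [iid_uniform]
    accepts. *)
Lemma history_event k (t : k.-tuple 'I_n) :
  exists b : nat -> 'I_n,
    forall w, history I k w = t <-> forall j, j \in iota 0 k -> I j w = b j.
Proof.
(* At k = 0 nothing is constrained and any b serves; the draws at an arbitrary outcome supply
   one. *)
elim: k t => [|k IH] t; first by exists (I ^~ point) => w; rewrite tuple0 (tuple0 t).
have [b bt] := IH [tuple of behead t].
exists (fun j => if j == k then thead t else b j) => w.
have -> : history I k.+1 w = t <->
    I k w = thead t /\ history I k w = [tuple of behead t].
  rewrite {1}(tuple_eta t) /=; split => [E|[-> ->]//].
  have [E1 E2] : I k w = thead t /\ val (history I k w) = behead t.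
    by case: (congr1 val E) => /= -> ->.
  by split => //; apply: val_inj.
rewrite bt -addn1 iotaD add0n; split => [[Ik Hj] j|H].
  rewrite mem_cat inE => /orP[jk|/eqP ->]; last by rewrite eqxx.
  by move: (jk); rewrite mem_iota add0n /= => /ltn_eqF ->; exact: Hj.
split; first by have := H k; rewrite eqxx mem_cat inE eqxx orbT; exact.
move=> j jk; have := H j; rewrite mem_cat jk => /(_ isT).
by move: jk; rewrite mem_iota add0n /= => /ltn_eqF ->.
Qed.

Lemma history_prob k (t : k.-tuple 'I_n) :
  measurable (history I k @^-1` [set t]) /\
  P (history I k @^-1` [set t]) = (n%:R^-1 ^+ k)%:E.
Proof.
have [mI uI indI] := iidI.
have [b bt] := history_event t.
have -> : history I k @^-1` [set t] =
    [set w | forall j, j \in iota 0 k -> [set b j] (I j w)].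
  by apply/seteqP; split => w /= /bt.
split; last first.
  rewrite (indI _ (fun j => [set b j])) ?iota_uniq // (eq_bigr (fun=> (n%:R^-1)%:E)) => [|j _]; last exact: uI.
  by rewrite prodEFin big_const_seq count_predT size_iota iter_mulr_1.
rewrite [X in measurable X](_ : _ =
    \bigcap_(j in [set` iota 0 k]) [set w | I j w = b j]); last first.
  by apply/seteqP; split => w /=.
by apply: fin_bigcap_measurable => //; exact: finite_seq.
Qed.

Let P_fiber k t := (@history_prob k t).2.
Let m_fiber k t := (@history_prob k t).1.

(** The next draw splits each fibre of the history, of mass n^-k, into n fibres of equal mass
    n^-(k+1). *)
Lemma integral_history_succ k (D : set (k.-tuple 'I_n))
    (psi : k.+1.-tuple 'I_n -> R) :
  (\int[P]_(w in history I k @^-1` D) (psi (history I k.+1 w))%:E =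
   \int[P]_(w in history I k @^-1` D)
     (n%:R^-1 * \sum_i psi [tuple of i :: history I k w])%:E)%E.
Proof.
rewrite (integral_finite_valued P (@m_fiber k) D
  (fun t => n%:R^-1 * \sum_i psi [tuple of i :: t])).
pose tl (t : k.+1.-tuple 'I_n) : k.-tuple 'I_n := behead_tuple t.
have tlE i (t : k.-tuple 'I_n) : tl [tuple of i :: t] = t by apply: val_inj.
have -> : history I k @^-1` D = history I k.+1 @^-1` [set t | D (tl t)].
  by apply/seteqP; split => w; rewrite /preimage /= tlE.
rewrite (integral_finite_valued P (@m_fiber k.+1)) big_mkcond /= sum_tuple_cons.
rewrite [RHS]big_mkcond /=; apply: eq_bigr => t _.
transitivity (\sum_i (if t \in D then
    (psi [tuple of i :: t] * n%:R^-1 ^+ k.+1)%:E else 0))%E.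
  apply: eq_bigr => i _; rewrite P_fiber (_ : (_ \in _) = (t \in D)) //.
  by apply/idP/idP; rewrite !inE /= tlE.
case: ifP => tD; last by rewrite big1.
rewrite sumEFin P_fiber -EFinM; congr EFin.
by rewrite -mulr_suml exprS; ring.
Qed.

End RandomScanProbability.

(** * Conditioning on the current random-scan state *)

Section RandomScanFiltration.
Variables (R : realType) (n : nat) (upd : factors R n -> factors R n).
Variable nu0 : factors R n.
Context d (Omega : measurableType d) (P : probability Omega R).
Variables (I : nat -> Omega -> 'I_n) (mu : nat -> Omega -> factors R n).
Hypotheses (iidI : iid_uniform P I) (run : random_scan_run upd I nu0 mu).

Let m_fiber k t := (@history_prob _ _ _ _ _ _ iidI k t).1.
Let P_fiber k t := (@history_prob _ _ _ _ _ _ iidI k t).2.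
Let muE := random_scan_history run.

(** The unions of fibres of the history form a sigma-algebra that contains the generators. *)
Lemma sigma_factors_history k A : sigma_factors (mu k) A ->
  exists D, A = history I k @^-1` D.
Proof.
pose S := [set A : set Omega |
  forall w w', history I k w = history I k w' -> A w -> A w'].
suff AS : sigma_factors (mu k) `<=` S.
  move=> /AS SA; exists [set t | exists w, A w /\ history I k w = t].
  by apply/seteqP; split => [w Aw|w [w' [Aw' /SA]]]; [exists w|exact].
apply: smallest_sub => [|_ [i [x [B [_ ->]]]] w w' ww' /=]; last first.
  by rewrite !muE ww'.
split => [w w' _ //|B SB w w' ww' [_ Bw]|B SB w w' ww' [j _ Bj]].
  by split => // Bw'; apply: Bw; exact: SB Bw'.
by exists j => //; exact: SB Bj.
Qed.

Lemma sigma_factors_measurable k A : sigma_factors (mu k) A -> measurable A.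
Proof.
move=> /sigma_factors_history[D ->].
exact: finite_preimage_measurable (@m_fiber k) D.
Qed.

(** A contains the whole history fibre of w, which has mass n^-k. *)
Lemma sigma_factors_pos k A w : sigma_factors (mu k) A -> A w -> (0 < P A)%E.
Proof.
move=> GA; have mA := sigma_factors_measurable GA.
have [D AD] := sigma_factors_history GA; rewrite AD => Dw.
have n0 : (0 < n)%N by exact: leq_ltn_trans (ltn_ord (I 0%N w)).
apply: (@lt_le_trans _ _ (P (history I k @^-1` [set history I k w]))).
  by rewrite P_fiber lte_fin exprn_gt0 // invr_gt0 ltr0n.
apply: le_measure; rewrite ?inE.
- exact: m_fiber.
- by rewrite -AD.
- by move=> w' /= E; rewrite /preimage /= E.
Qed.

(** The state takes finitely many values, so the preimage is a finite union of level sets, each a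
    finite intersection of generators. *)
Lemma sigma_factors_preimage k (T : Type) (phi : factors R n -> T) (B : set T) :
  sigma_factors (mu k) ((fun w => phi (mu k w)) @^-1` B).
Proof.
have level (nu : factors R n) : sigma_factors (mu k) [set w | mu k w = nu].
  have -> : [set w | mu k w = nu] = \bigcap_(p in [set: 'I_n * bool])
      [set w | mu k w p.1 p.2 = nu p.1 p.2].
    apply/seteqP; split => [w /= E p _ /=|w H]; first by rewrite E.
    by apply/funext => i; apply/funext => x; exact: (H (i, x)).
  apply: (@fin_bigcap_measurable _ (g_sigma_algebraType _)).
    exact: finite_finset.
  move=> [i x] _; apply: sub_sigma_algebra.
  by exists i, x, [set nu i x]; split => //; exact: measurable_set1.
have -> : (fun w => phi (mu k w)) @^-1` B =
    \bigcup_(t in [set t : k.-tuple 'I_n | B (phi (scan_state upd nu0 t))])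
      [set w | mu k w = scan_state upd nu0 t].
  apply/seteqP; split => [w Bw|w [t Bt /= E]]; last by rewrite /preimage /= E.
  by exists (history I k w); rewrite /= -?muE.
apply: (@fin_bigcup_measurable _ (g_sigma_algebraType _)).
  exact: finite_finset.
by move=> t _; exact: level.
Qed.

(** The average over the next coordinate is a function of [mu k], and events of [mu k] are events of
    the history, so averaging over the next draw gives the integral identity. *)
Lemma random_scan_cond_exp k (psi : factors R n -> R) :
  is_cond_exp P (sigma_factors (mu k)) (fun w => psi (mu k.+1 w))
    (fun w => n%:R^-1 * \sum_i psi (scan_step upd i (mu k w))).
Proof.
split.
- have -> : EFin \o (fun w => n%:R^-1 * \sum_i psi (scan_step upd i (mu k w))) =
      EFin \o ((fun t : k.-tuple 'I_n => n%:R^-1 *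
        \sum_i psi (scan_step upd i (scan_state upd nu0 t))) \o history I k).
    by apply/funext => w; rewrite /= muE.
  exact: finite_valued_integrable (@m_fiber k) _.
- move=> B _; exact: (@sigma_factors_preimage k R
    (fun nu => n%:R^-1 * \sum_i psi (scan_step upd i nu)) B).
- move=> A /sigma_factors_history[D ->].
  have := integral_history_succ iidI D (fun t => psi (scan_state upd nu0 t)).
  under eq_integral do rewrite -muE.
  move=> ->; apply: eq_integral => w _; rewrite muE.
  by [].
Qed.

Lemma random_scan_expectation_succ k (psi : factors R n -> R) :
  ('E_P[fun w => psi (mu k.+1 w)] =
   'E_P[fun w => (n%:R^-1 * \sum_i psi (scan_step upd i (mu k w)))%R])%E.
Proof.
have [_ _ /(_ setT)] := random_scan_cond_exp k psi.
rewrite expectation.unlock => <- //.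
by have := @sigma_factors_preimage k _ id setT; rewrite preimage_setT.
Qed.

Lemma random_scan_expectation k (psi : factors R n -> R) :
  ('E_P[fun w => psi (mu k w)] =
   (\sum_(t : k.-tuple 'I_n) psi (scan_state upd nu0 t) * n%:R^-1 ^+ k)%:E)%E.
Proof.
under eq_fun do rewrite muE.
have := expectation_finite_valued P (@m_fiber k)
  (fun t => psi (scan_state upd nu0 t)).
by move=> ->; rewrite -sumEFin; apply: eq_bigr => t _; rewrite P_fiber EFinM.
Qed.

End RandomScanFiltration.

(** * One-step bound and decay in expectation for the random scan *)

Section RandomScanRate.
Variables (R : realType) (n : nat) (beta : R) (h : 'I_n -> R).
Hypotheses (beta_ge0 : 0 <= beta) (n_gt0 : (0 < n)%N).
Let upd := cw_update beta h.
Variable mu_star : factors R n.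
Hypotheses (star_pmf : forall i, is_pmf (mu_star i))
  (star_fixed : fixed_point upd mu_star).

(** Of the n possible draws, i = j updates factor j and is controlled by row j of R; the other n - 1
    leave it alone, whence the weight (n - 1) / n of the identity. *)
Lemma scan_step_tv (nu : factors R n) j : (forall i, is_pmf (nu i)) ->
  n%:R^-1 * (\sum_i tv_vec (scan_step upd i nu) mu_star j 0) <=
  (random_scan_mx (cw_mx n beta) *m tv_vec nu mu_star) j 0.
Proof.
move=> nu_pmf; rewrite mulmxDl -!scalemxAl mul1mx.
rewrite [leRHS]mxE [X in _ <= X + _]mxE [X in _ <= _ + X]mxE.
rewrite [tv_vec nu _ _ _]mxE (bigD1 j) //= {1}/scan_step [tv_vec _ _ _ _]mxE eqxx.
rewrite (eq_bigr (fun=> tv (nu j) (mu_star j))) => [|i ij]; last first.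
  by rewrite mxE /scan_step eq_sym (negbTE ij).
rewrite sumr_const (cardC1 j) card_ord -[_ *+ n.-1]mulr_natl mulrDr -subn1 natrB //.
apply: lerD; last by rewrite mulrA [n%:R^-1 * (_ - 1)]mulrC.
rewrite ler_wpM2l ?invr_ge0 // (eq_tv (fun=> erefl) (star_fixed j)).
apply: le_trans (cw_update_tv h beta_ge0 j nu_pmf star_pmf) _.
by rewrite mxE; apply: ler_sum => i _; rewrite [tv_vec _ _ _ _]mxE.
Qed.

Context d (Omega : measurableType d) (P : probability Omega R).
Variables (I : nat -> Omega -> 'I_n) (nu0 : factors R n).
Variable mu : nat -> Omega -> factors R n.
Hypotheses (nu0_pmf : forall i, is_pmf (nu0 i)) (iidI : iid_uniform P I)
  (run : random_scan_run upd I nu0 mu).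

Lemma random_scan_decay l :
  random_scan_mx (cw_mx n beta) *m const_mx 1 = l *: (const_mx 1 : 'cV[R]_n) ->
  exists C : R, forall k,
    ('E_P[fun w => tv (prod_pmf (mu k w)) (prod_pmf mu_star)]
      <= (C * l ^+ k)%:E)%E.
Proof.
move=> Bl; set B := random_scan_mx _ in Bl *.
have st_pmf := scan_state_pmf nu0_pmf (cw_update_pmf beta h).
(* Expectations as finite sums, whose monotonicity and linearity are plain algebra. The expected
   distances then satisfy the matrix recursion. *)
pose E k (psi : factors R n -> R) :=
  \sum_(s : k.-tuple 'I_n) psi (scan_state upd nu0 s) * n%:R^-1 ^+ k.
have EE k psi : 'E_P[fun w => psi (mu k w)]%E = (E k psi)%:E.
  exact: random_scan_expectation iidI run k psi.
have leE k psi psi' : (forall s : seq 'I_n,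
    psi (scan_state upd nu0 s) <= psi' (scan_state upd nu0 s)) ->
    E k psi <= E k psi'.
  by move=> H; apply: ler_sum => s _; rewrite ler_wpM2r ?exprn_ge0 ?invr_ge0.
pose t k : 'cV[R]_n := \col_j E k (fun nu => tv_vec nu mu_star j 0).
have tB k : lemx (t k.+1) (B *m t k).
  move=> j j0; rewrite (ord1 j0) mxE.
  have -> : E k.+1 (fun nu => tv_vec nu mu_star j 0) = E k (fun nu =>
      n%:R^-1 * \sum_i tv_vec (scan_step upd i nu) mu_star j 0).
    apply: EFin_inj; rewrite -!EE.
    exact: (random_scan_expectation_succ iidI run k (fun nu => tv_vec nu mu_star j 0)).
  apply: le_trans (_ : E k (fun nu => (B *m tv_vec nu mu_star) j 0) <= _).
    by apply: leE => s; exact: scan_step_tv.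
  rewrite le_eqVlt; apply/orP; left; apply/eqP.
  rewrite /E [RHS]mxE; under [LHS]eq_bigr do rewrite mxE mulr_suml.
  rewrite exchange_big /=; apply: eq_bigr => m _; rewrite [t k m 0]mxE mulr_sumr.
  by apply: eq_bigr => s _; rewrite mulrA.
have [|i|C tC] := perron_decay _ _ Bl tB.
- exact: random_scan_mx_ge0.
- by rewrite mxE.
exists (\sum_(j < n) C) => k.
rewrite (EE k (fun nu => tv (prod_pmf nu) (prod_pmf mu_star))) lee_fin.
apply: le_trans (_ : E k (fun nu => \sum_j tv_vec nu mu_star j 0) <= _).
  apply: leE => s; apply: le_trans (tv_prod_pmf (st_pmf s) star_pmf) _.
  by apply: ler_sum => j _; rewrite mxE.
rewrite mulr_suml.
apply: le_trans (_ : \sum_j t k j 0 <= _); last first.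
  by apply: ler_sum => j _; have := tC k j 0; rewrite [leRHS]mxE [const_mx _ _ _]mxE mulr1.
rewrite le_eqVlt; apply/orP; left; apply/eqP; rewrite /E.
under [LHS]eq_bigr do rewrite mulr_suml.
by rewrite exchange_big /=; apply: eq_bigr => j _; rewrite [t k j 0]mxE.
Qed.

End RandomScanRate.

(** * From coordinatewise recursions to rates for the product laws *)

Lemma product_decay (R : realType) (n : nat) (A : 'M[R]_n) (v : 'cV[R]_n) (l : R)
    (mu : nat -> factors R n) (mu_star : factors R n) :
  (forall i j, 0 <= A i j) -> (forall i, 0 < v i 0) -> A *m v = l *: v ->
  (forall k i, is_pmf (mu k i)) -> (forall i, is_pmf (mu_star i)) ->
  (forall k, lemx (tv_vec (mu k.+1) mu_star) (A *m tv_vec (mu k) mu_star)) ->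
  exists C : R, forall k, tv (prod_pmf (mu k)) (prod_pmf mu_star) <= C * l ^+ k.
Proof.
move=> A0 v0 Av mu_pmf star_pmf muA.
have [C muC] := perron_decay A0 v0 Av muA.
exists (\sum_j C * v j 0) => k; rewrite mulr_suml.
apply: le_trans (tv_prod_pmf (mu_pmf k) star_pmf) _; apply: ler_sum => j _.
by have := muC k j 0; rewrite !mxE mulrAC.
Qed.

Theorem proposition18 (R : realType) (n : nat) (beta : R) (h : 'I_n -> R)
    (n_ge1 : (1 <= n)%N) (beta_gt0 : 0 < beta)
    (beta_small : `|beta| * ((n%:R - 1) / n%:R) < 1) :
  let A := cw_mx n beta in
  let upd := cw_update beta h in
  (* upd is the coordinate-ascent update for the target curie_weiss beta h *)
  (forall nu : factors R n, (forall i, is_pmf (nu i)) ->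
     forall i x, upd nu i x = coordinate_update (curie_weiss beta h) nu i x) /\
  (exists mu_star : factors R n,
    [/\ forall i, is_pmf (mu_star i),
        fixed_point upd mu_star,
        forall nu : factors R n, (forall i, is_pmf (nu i)) ->
          fixed_point upd nu -> forall i x, nu i x = mu_star i x
      & [/\
  (* sequential *)
        spectral_radius (sequential_mx A) < 1 /\
        (forall mu : nat -> factors R n,
          (forall i, is_pmf (mu 0%N i)) -> sequential_run upd mu ->
          (forall k, lemx (tv_vec (mu k.+1) mu_star)
                          (sequential_mx A *m tv_vec (mu k) mu_star)) /\
          (exists C : R, forall k,
            tv (prod_pmf (mu k)) (prod_pmf mu_star)
              <= C * spectral_radius (sequential_mx A) ^+ k)),
  (* random scan *)
        spectral_radius (random_scan_mx A) < 1 /\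
        (forall (d : measure_display) (Omega : measurableType d)
            (P : probability Omega R) (I : nat -> Omega -> 'I_n)
            (nu0 : factors R n) (mu : nat -> Omega -> factors R n),
          (forall i, is_pmf (nu0 i)) -> iid_uniform P I ->
          random_scan_run upd I nu0 mu ->
          (forall k i,
            let T w := tv_vec (mu k w) mu_star in
            let T' w := tv_vec (mu k.+1 w) mu_star in
            (exists Y, is_cond_exp P (sigma_factors (mu k))
                         (fun w => T' w i 0) Y) /\
            (forall Y, is_cond_exp P (sigma_factors (mu k))
                         (fun w => T' w i 0) Y ->
               {ae P, forall w, Y w <= (random_scan_mx A *m T w) i 0})) /\
          (exists C : R, forall k,
            ('E_P[fun w => tv (prod_pmf (mu k w)) (prod_pmf mu_star)]
              <= (C * spectral_radius (random_scan_mx A) ^+ k)%:E)%E))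
  (* parallel *)
      & spectral_radius A < 1 /\
        (forall mu : nat -> factors R n,
          (forall i, is_pmf (mu 0%N i)) -> parallel_run upd mu ->
          (forall k, lemx (tv_vec (mu k.+1) mu_star)
                          (A *m tv_vec (mu k) mu_star)) /\
          (exists C : R, forall k,
            tv (prod_pmf (mu k)) (prod_pmf mu_star)
              <= C * spectral_radius A ^+ k))]]).
Proof.
move=> A upd; rewrite (gtr0_norm beta_gt0) in beta_small.
have beta_ge0 := ltW beta_gt0.
have upd_pmf := cw_update_pmf beta h.
split=> [nu nu_pmf i x|]; first by rewrite coordinate_update_curie_weiss.
have [mu_star [star_pmf star_fixed]] := cw_fixed_exists h beta_ge0 beta_small n_ge1.
exists mu_star; split => // [nu nu_pmf nu_fixed i|].
  exact: (cw_fixed_unique beta_ge0 beta_small nu_pmf star_pmf nu_fixed star_fixed).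
have A_ge0 : forall i j, 0 <= A i j := cw_mx_ge0 beta_ge0.
have one_gt0 (i : 'I_n) : 0 < (const_mx 1 : 'cV[R]_n) i 0 by rewrite mxE.
have n1 : 0 <= n%:R - 1 :> R by rewrite subr_ge0 ler1n.
have l_ge0 : 0 <= beta * ((n%:R - 1) / n%:R) by rewrite mulr_ge0 // divr_ge0.
split; split.
- have [v [l [v0 /andP[l0 l1] Av]]] := sequential_perron n_ge1 beta_gt0 beta_small.
  have S_ge0 := sequential_mx_ge0 A_ge0.
  by rewrite (spectral_radius_perron n_ge1 S_ge0 v0 l0 Av).
- move=> mu mu0 run.
  have [v [l [v0 /andP[l0 l1] Av]]] := sequential_perron n_ge1 beta_gt0 beta_small.
  have S_ge0 := sequential_mx_ge0 A_ge0.
  rewrite (spectral_radius_perron n_ge1 S_ge0 v0 l0 Av).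
  have mu_pmf k i : is_pmf (mu k i).
    by case: k => // k; rewrite (funext (run k i)); exact: upd_pmf.
  have step k : lemx (tv_vec (mu k.+1) mu_star)
      (sequential_mx A *m tv_vec (mu k) mu_star).
    apply: (sequential_mx_le A_ge0) => i; last by rewrite mxE eqxx.
    rewrite mxE (eq_tv (run k i) (star_fixed i)).
    apply: le_trans (cw_update_tv h beta_ge0 i _ star_pmf) _.
      by move=> j; case: ifP.
    by apply: ler_sum => j _; case: ifP => _; rewrite [tv_vec _ _ _ _]mxE.
  by split=> //; exact: product_decay Av mu_pmf star_pmf step.
- rewrite (spectral_radius_perron n_ge1 (random_scan_mx_ge0 beta_ge0 n_ge1)
    one_gt0 _ (random_scan_mx_const beta n_ge1)).
    (* With l = beta (n - 1) / n the rate is (l + n - 1) / n, below 1 exactly when l < 1. *)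
    by rewrite -mulrDl ltr_pdivrMr ?ltr0n // mul1r addrCA gtrDl subr_lt0.
  by rewrite addr_ge0 // divr_ge0.
- move=> d Omega P I nu0 mu nu0_pmf iidI run.
  rewrite (spectral_radius_perron n_ge1 (random_scan_mx_ge0 beta_ge0 n_ge1)
    one_gt0 _ (random_scan_mx_const beta n_ge1)); last first.
    by rewrite addr_ge0 // divr_ge0.
  split=> [k i T T'|]; last first.
    exact: (random_scan_decay beta_ge0 n_ge1 star_pmf star_fixed nu0_pmf iidI run
      (random_scan_mx_const beta n_ge1)).
  have Y0 := random_scan_cond_exp iidI run k (fun nu => tv_vec nu mu_star i 0).
  split; first by eexists; exact: Y0.
  (* Every version agrees with the explicit one at each outcome, so a pointwise bound suffices. *)
  move=> Y condY; apply: aeW => w.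
  have -> := is_cond_exp_unique (sigma_factors_measurable iidI run (k := k))
    (sigma_factors_pos iidI run (k := k)) condY Y0 w.
  apply: scan_step_tv => // j; rewrite (random_scan_history run).
  exact: scan_state_pmf.
- by rewrite (spectral_radius_perron n_ge1 A_ge0 one_gt0 l_ge0 (cw_mx_const n beta)).
- move=> mu mu0 run.
  rewrite (spectral_radius_perron n_ge1 A_ge0 one_gt0 l_ge0 (cw_mx_const n beta)).
  have mu_pmf k i : is_pmf (mu k i).
    by case: k => // k; rewrite (funext (run k i)); exact: upd_pmf.
  have step k : lemx (tv_vec (mu k.+1) mu_star) (A *m tv_vec (mu k) mu_star).
    move=> i j; rewrite (ord1 j) mxE (eq_tv (run k i) (star_fixed i)).
    apply: le_trans (cw_update_tv h beta_ge0 i (mu_pmf k) star_pmf) _.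
    by rewrite mxE; apply: ler_sum => m _; rewrite [tv_vec _ _ _ _]mxE.
  by split=> //; exact: product_decay (cw_mx_const n beta) mu_pmf star_pmf step.
Qed.
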